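(* Let $A$ and $X$ be sets and let $R \subseteq A \times X$ be a relation. Let $D_A$, $D_X$ be the Dowker complexes of $R$, let $P_A$, $P_X$ be their face posets, and let $\tilde{R} \subseteq P_A \times P_X$ be the relation induced by $R$, i.e. $\sigma_A \tilde{R} \sigma_X$ if and only if $aRx$ for all $a \in \sigma_A$ and $x \in \sigma_X$. Let $D_A \times_{\tilde{R}} D_X$ be the relational product complex. Then $$\|D_A\| \simeq D_A \times_{\tilde{R}} D_X \simeq \|D_X\|,$$ where $\simeq$ denotes homotopy equivalence.
   Context: For a relation $R \subseteq A \times X$, write $aRx$ for $(a,x)\in R$. The Dowker complex $D_A$ is the abstract simplicial complex whose simplices are the non-empty finite subsets $\sigma_A \subseteq A$ such that $\sigma_A \times \{x\} \subseteq R$ for some $x \in X$; symmetrically, the simplices of $D_X$ are the non-empty finite subsets $\sigma_X \subseteq X$ such that $\{a\} \times \sigma_X \subseteq R$ for some $a \in A$. The face poset of a simplicial complex is the set of its (non-empty) simplices ordered by inclusion. $\|K\|$ denotes the geometric realization of a simplicial complex $K$. For simplicial complexes $K, M$ and a relation $\tilde{R} \subseteq P_K \times P_M$ between their face posets (a subset that is downward closed in the product order), the relational product complex is the regular CW complex $$K \times_{\tilde{R}} M = \bigcup_{\sigma \tilde{R} \tau} \|\sigma\| \times \|\tau\|,$$ a subcomplex of the product $\|K\| \times \|M\|$, where the product carries the compactly generated CW topology (the weak topology with respect to the closed cells $\|\sigma\| \times \|\tau\|$). *)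

(* Defs.v *)
From HB Require Import structures.
From mathcomp Require Import all_boot all_order all_algebra finmap.
From mathcomp Require Import all_classical all_reals all_analysis.

Set Implicit Arguments.
Unset Strict Implicit.
Unset Printing Implicit Defensive.

Import Order.TTheory GRing.Theory Num.Theory.
Import numFieldNormedType.Exports.

Local Open Scope classical_set_scope.
Local Open Scope ring_scope.

(* The values of [H] at times outside [0, 1] are irrelevant. *)
Definition homotopic (R : realType) (S T : topologicalType) (f g : S -> T) :=
  exists H : S * R -> T,
    [/\ {within [set p : S * R | 0 <= p.2 <= 1], continuous H},
        forall x, H (x, 0) = f x
      & forall x, H (x, 1) = g x].

Definition homotopy_equivalent (R : realType) (S T : topologicalType) :=
  exists (f : S -> T) (g : T -> S),
    [/\ continuous f, continuous g,
        homotopic R (g \o f) idfun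
      & homotopic R (f \o g) idfun].

(* [T] retopologized by the weak topology with respect to the members of [C],
   each with its subspace topology: [U] is open iff [U `&` c] is relatively
   open in [c] for every [c] in [C]. *)
Definition coherent (T : topologicalType) (C : set (set T)) : Type := T.

Section coherent_topology.
Context (T : topologicalType) (C : set (set T)).

Definition coherent_open (U : set (coherent C)) : Prop :=
  forall c, C c -> open (U : set (subspace c)).

Lemma coherent_openT : coherent_open setT.
Proof. by move=> c _; exact: openT. Qed.

Lemma coherent_openI (U V : set (coherent C)) :
  coherent_open U -> coherent_open V -> coherent_open (U `&` V).
Proof. by move=> oU oV c Cc; apply: openI; [exact: oU|exact: oV]. Qed.

Lemma coherent_open_bigcup (I : Type) (F : I -> set (coherent C)) :
  (forall i, coherent_open (F i)) -> coherent_open (\bigcup_i F i).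
Proof. by move=> oF c Cc; apply: bigcup_open => i _; exact: oF. Qed.

HB.instance Definition _ := Choice.copy (coherent C) T.
HB.instance Definition _ := isOpenTopological.Build (coherent C)
  coherent_openT coherent_openI coherent_open_bigcup.

End coherent_topology.

(* The elements of [V] need not all be vertices of the complex. *)
Record simplicial_complex (V : choiceType) := SimplicialComplex {
  simplices : set {fset V};
  simplices_neq0 : forall s, simplices s -> s != fset0;
  simplices_sub : forall s t, simplices s ->
    (t `<=` s)%fset -> t != fset0 -> simplices t
}.

Section realization.
Context (R : realType) (V : choiceType).

(* The simplex spanned by [s], in barycentric coordinates. As [s] is finite, the
   topology of pointwise convergence induces the Euclidean topology on it. *)
Definition geometric_simplex (s : {fset V}) : set {ptws V -> R} :=
  [set t | [/\ forall v, 0 <= t v,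
               forall v, v \notin s -> t v = 0
             & \sum_(v <- s) t v = 1]].

Definition realization_points (K : simplicial_complex V) : topologicalType :=
  set_type (\bigcup_(s in simplices K) geometric_simplex s).

Definition realization (K : simplicial_complex V) : topologicalType :=
  coherent [set [set p : realization_points K | geometric_simplex s (set_val p)]
           | s in simplices K].

Definition closed_simplex (K : simplicial_complex V) (s : {fset V}) :
    set (realization K) :=
  [set p | geometric_simplex s (set_val (p : realization_points K))].

End realization.

Arguments closed_simplex R {V} K s _.

Section product.
Context (R : realType) (V W : choiceType).
Context (K : simplicial_complex V) (M : simplicial_complex W).

Definition closed_cell (s : {fset V}) (t : {fset W}) :
    set (realization R K * realization R M) :=
  closed_simplex R K s `*` closed_simplex R M t.

Definition product_complex : topologicalType :=
  coherent [set c | exists s t,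
    [/\ simplices K s, simplices M t & c = closed_cell s t]].

(* The set of faces is ordered by inclusion of the underlying finite sets. *)
Definition face (U : choiceType) (L : simplicial_complex U) : Type :=
  set_type (simplices L).

Record face_relation := FaceRelation {
  related : set (face K * face M);
  related_down : forall (s s' : face K) (t t' : face M),
    (set_val s' `<=` set_val s)%fset -> (set_val t' `<=` set_val t)%fset ->
    related (s, t) -> related (s', t')
}.

Definition relational_product (Q : face_relation) : topologicalType :=
  set_type (\bigcup_(p in related Q)
    (closed_cell (set_val p.1) (set_val p.2) : set product_complex)).

End product.

Section dowker.
Context (A X : choiceType) (r : set (A * X)).

Definition dowker_left_simplices : set {fset A} :=
  [set s | s != fset0 /\ exists x, forall a, a \in s -> r (a, x)].

Definition dowker_right_simplices : set {fset X} :=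
  [set t | t != fset0 /\ exists a, forall x, x \in t -> r (a, x)].

Lemma dowker_left_neq0 s : dowker_left_simplices s -> s != fset0.
Proof. by case. Qed.

Lemma dowker_left_sub s t : dowker_left_simplices s ->
  (t `<=` s)%fset -> t != fset0 -> dowker_left_simplices t.
Proof.
move=> [_ [x rx]] /fsubsetP ts t0; split=> //.
by exists x => a /ts; exact: rx.
Qed.

Lemma dowker_right_neq0 t : dowker_right_simplices t -> t != fset0.
Proof. by case. Qed.

Lemma dowker_right_sub s t : dowker_right_simplices s ->
  (t `<=` s)%fset -> t != fset0 -> dowker_right_simplices t.
Proof.
move=> [_ [a ra]] /fsubsetP ts t0; split=> //.
by exists a => x /ts; exact: ra.
Qed.

Definition dowker_left : simplicial_complex A :=
  SimplicialComplex dowker_left_neq0 dowker_left_sub.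

Definition dowker_right : simplicial_complex X :=
  SimplicialComplex dowker_right_neq0 dowker_right_sub.

Definition induced_related : set (face dowker_left * face dowker_right) :=
  [set p | forall a x, a \in set_val p.1 -> x \in set_val p.2 -> r (a, x)].

Lemma induced_related_down (s s' : face dowker_left) (t t' : face dowker_right) :
  (set_val s' `<=` set_val s)%fset -> (set_val t' `<=` set_val t)%fset ->
  induced_related (s, t) -> induced_related (s', t').
Proof.
move=> /fsubsetP s's /fsubsetP t't st a x as' xt'.
by apply: st; [exact: s's|exact: t't].
Qed.

Definition induced_relation : face_relation dowker_left dowker_right :=
  FaceRelation induced_related_down.

End dowker.

(* Main.v *)
(* Write [t] for a point of the realization of D_A in barycentric
   coordinates, and choose for every simplex [rho] of D_A a finite set [sel
   rho] of elements of X related to all of [rho] (a singleton, so that no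
   default element is needed). Fix a continuous threshold [level t] between 0
   and the largest coordinate of [t]. Cutting the coordinates off at [level
   t] and normalizing gives [shrink t], supported on the vertices above the
   level. The convex combination [spread t] of the vertices in [sel rho],
   weighted by functions that vanish unless [rho] contains all the vertices
   above the level and is contained in the support of [t], is a point of D_X.
   As the vertices in [sel rho] are related to all of [rho], the support of
   [shrink t] is related to that of [spread t], so [t |-> (shrink t, spread
   t)] maps into the relational product. It is a homotopy inverse of the
   projection [(t, u) |-> t]: one composite is [shrink], and the other one is
   joined to the identity by [(t, u) ~ (shrink t, u) ~ (shrink t, spread t)],
   all homotopies being straight lines inside cells. On every closed cell
   these maps take values in finitely many cells, which gives continuity for
   the weak topologies. The argument only uses the relation, so exchanging A
   and X gives the second equivalence. *)
Require Import Defs.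
From mathcomp Require Import all_boot all_order all_algebra finmap.
From mathcomp Require Import lra.
From mathcomp Require Import all_classical all_reals all_analysis.

Set Implicit Arguments.
Unset Strict Implicit.
Unset Printing Implicit Defensive.

Import Order.TTheory GRing.Theory Num.Theory.
Import numFieldNormedType.Exports.

Local Open Scope classical_set_scope.
Local Open Scope ring_scope.

(** * Weak topologies *)

Section complexes.
Variable R : realType.

(** The converse implication is automatic, as the inclusion of [c] is continuous. *)
Definition weak_topology (S : topologicalType) (C : set (set S)) :=
  forall U : set S, (forall c, C c -> open ((set_val : c -> S) @^-1` U)) ->
    open U.

(** The weak topology of an infinite complex may be strictly finer than the one defined by the
    coordinates, so these detect continuity only for maps into a finite union of cells. *)
Definition tests_continuity (S : topologicalType) (I : Type) (co : I -> S -> R)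
    (C : set (set S)) :=
  forall (T : topologicalType) (f : T -> S) (D : set (set S)),
    finite_set D -> D `<=` C -> (forall x, exists2 c, D c & c (f x)) ->
    (forall i, continuous (co i \o f)) -> continuous f.

(* Clauses [cells_weak] and [cells_tests] are the universal properties for maps
   out of and into the space; the continuous coordinates reduce the continuity
   of a map into the space to that of real-valued functions, as soon as its image
   lies in finitely many cells. *)
Record cell_complex (S : topologicalType) (I : Type) (co : I -> S -> R)
    (C : set (set S)) : Prop := CellComplex {
  coordinates_continuous : forall i, continuous (co i);
  cells_closed : forall c, C c -> closed c;
  cells_weak : weak_topology C;
  cells_tests : tests_continuity co C }.

Lemma set_val_continuous (S : topologicalType) (c : set S) :
  continuous (set_val : c -> S).
Proof. exact: initial_continuous. Qed.

Lemma set_type_continuous (S T : topologicalType) (c : set S) (f : T -> c) :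
  continuous (set_val \o f) -> continuous f.
Proof. exact: continuous_comp_initial. Qed.

Lemma weak_continuous (S T : topologicalType) (C : set (set S)) (f : S -> T) :
  weak_topology C -> (forall c, C c -> continuous (f \o (set_val : c -> S))) ->
  continuous f.
Proof.
move=> wC fc; apply/continuousP => A oA; apply: wC => c /fc.
by move/continuousP/(_ A oA).
Qed.

Lemma pair_continuous (S T U : topologicalType) (f : S -> T) (g : S -> U) :
  continuous f -> continuous g -> continuous (fun x => (f x, g x)).
Proof. by move=> cf cg x; apply: cvg_pair; [exact: cf|exact: cg]. Qed.

Lemma comp_continuous (S T U : topologicalType) (f : S -> T) (g : T -> U) :
  continuous f -> continuous g -> continuous (g \o f).
Proof. by move=> cf cg x; apply: continuous_comp; [exact: cf|exact: cg]. Qed.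

Section currying.
Import ArrowAsCompactOpen.

(* Products with [R] preserve weak topologies because [R] is locally compact:
   [f] is continuous iff its curried form is, for the compact-open topology. *)
Lemma weak_prod_continuous (S T : topologicalType) (C : set (set S))
    (f : S * R -> T) : weak_topology C ->
  (forall x, exists2 c, C c & c x) ->
  (forall c, C c -> continuous (fun p : c * R => f (set_val p.1, p.2))) ->
  continuous f.
Proof.
move=> wC covC fc.
have -> : f = uncurry (curry f) by apply/funext => -[].
apply: continuous_uncurry_regular.
- exact: locally_compactR.
- exact: uniform_regular.
- apply: (weak_continuous wC) => c /fc.
  exact: (@continuous_curry_fun _ _ _ (fun p : c * R => f (set_val p.1, p.2))).
- move=> x; have [c /fc cc cx] := covC x.
  exact: (continuous_curry cc).2 (exist _ x (mem_set cx)).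
Qed.

End currying.

Lemma coherent_openE (T : topologicalType) (C : set (set T))
    (U : set (coherent C)) : open U = coherent_open U.
Proof. by []. Qed.

(** The point is the topology of the cells: [coherent_open] tests with the one from [T],
    [weak_topology] with the one from [coherent C]. A trace open for the latter extends to an open
    [V] of [coherent C], whose trace is open for the former by definition. *)
Lemma coherent_weak (T : topologicalType) (C : set (set T)) :
  @weak_topology (coherent C) C.
Proof.
move=> U oU; rewrite coherent_openE => c Cc; have [V oV VU] := oU c Cc.
rewrite coherent_openE in oV.
have [W oW WV] := (open_subspaceP (c : set T) (V : set T)).1 (oV c Cc).
apply/open_subspaceP; exists W => //; rewrite WV.
apply/seteqP; split=> x [Vx cx]; split=> //.
  by have : (set_val @^-1` V) (exist _ x (mem_set cx) : c) by []; rewrite VU.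
by have : (set_val @^-1` U) (exist _ x (mem_set cx) : c) by []; rewrite -VU.
Qed.

Lemma coherent_id_continuous (T : topologicalType) (C : set (set T)) :
  continuous (id : coherent C -> T).
Proof.
apply/continuousP => A oA; rewrite coherent_openE => c _; apply/open_subspaceP.
by exists A.
Qed.

Lemma closed_finite_cover (T : topologicalType) (D : set (set T)) (F : set T) :
  finite_set D -> (forall x, exists2 c, D c & c x) ->
  (forall c, D c -> closed (F `&` c)) -> closed F.
Proof.
move=> finD covD Fc; have -> : F = \bigcup_(c in D) (F `&` c).
  apply/seteqP; split=> [x Fx|x [c _ []//]].
  by have [c Dc cx] := covD x; exists c.
exact: closed_bigcup.
Qed.

(** On a closed cell, [T] and [coherent C] have the same closed sets. If finitely many cells contain
    the values of [f], the preimage of a closed set is therefore a finite union of preimages of sets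
    closed in [T], and continuity into [T] suffices. *)
Lemma coherent_complex (T : topologicalType) (I : Type) (co : I -> T -> R)
    (C : set (set T)) :
  (forall i, continuous (co i)) -> (forall c, C c -> closed c) ->
  tests_continuity co C -> @cell_complex (coherent C) I co C.
Proof.
move=> cco Ccl tC; split.
- by move=> i; apply: (comp_continuous (@coherent_id_continuous T C)).
- move=> c /Ccl cc.
  by have /continuous_closedP := @coherent_id_continuous T C; apply.
- exact: coherent_weak.
- move=> S f D finD DC covD fco.
  have cf : continuous (f : S -> T) by apply: (tC _ _ D).
  apply/continuous_closedP => F clF.
  apply: (@closed_finite_cover _ [set f @^-1` c | c in D]).
  + exact: finite_image.
  + by move=> x; have [c Dc cx] := covD x; exists (f @^-1` c) => //; exists c.
  + move=> _ [c Dc <-]; have Cc := DC c Dc.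
    have /closed_subspaceP[G clG GF] : closed (F : set (subspace (c : set T))).
      by rewrite -openC; apply: (closed_openC clF).
    have -> : f @^-1` F `&` f @^-1` c = (f : S -> T) @^-1` (G `&` c).
      by rewrite GF.
    have /continuous_closedP := cf; apply.
    by apply: closedI => //; exact: Ccl.
Qed.

Lemma eq_closed (T : topologicalType) (A B : set T) :
  A = B -> closed B -> closed A.
Proof. by move=> ->. Qed.

Lemma closed_set_type (S : topologicalType) (c : set S) (F : set c) :
  closed F -> exists2 G, closed G & F = set_val @^-1` G.
Proof.
rewrite -openC => -[G oG GF]; exists (~` G); first exact: open_closedC.
exact: etrans (esym (setCK F)) (congr1 setC (esym GF)).
Qed.

(** Serves to carry the finite families of cells in [tests_continuity] from one space to another. *)
Lemma finite_choose (T T' : Type) (D : set (set T)) (C : set (set T'))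
    (Q : set T -> set T' -> Prop) : finite_set D ->
  (forall d, D d -> exists2 c, C c & Q d c) ->
  exists D', [/\ finite_set D', D' `<=` C &
    forall d, D d -> exists2 c, D' c & Q d c].
Proof.
move=> finD DC.
have /choice[g gP] : forall d, exists c, D d -> C c /\ Q d c.
  move=> d; have [/DC[c Cc dc]|nDd] := pselect (D d); first by exists c.
  by exists set0 => /nDd.
exists (g @` D); split; first exact: finite_image.
  by move=> _ [d Dd <-]; exact: (gP d Dd).1.
by move=> d Dd; exists (g d); [exists d|exact: (gP d Dd).2].
Qed.

(** A subset of [Z] that is closed in every cell of [C'] is closed in all of [S]: its trace on a
    cell [c] of [C] is the finite union of its traces on the members of [D]. Hence the subspace
    topology of [Z] is again weak. *)
Lemma subcomplex (S : topologicalType) (I : Type) (co : I -> S -> R)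
    (C C' : set (set S)) (Z : set S) :
  cell_complex co C -> C' `<=` C -> (forall c, C' c -> c `<=` Z) ->
  (forall c, C c -> exists D, [/\ finite_set D, D `<=` C' &
     forall x, c x -> Z x -> exists2 d, D d & d x]) ->
  @cell_complex Z I (fun i => co i \o set_val) [set set_val @^-1` c | c in C'].
Proof.
move=> [cco Ccl wC tC] C'C C'Z cover; split.
- by move=> i; apply: comp_continuous => //; exact: set_val_continuous.
- move=> _ [c C'c <-].
  have /continuous_closedP := @set_val_continuous S Z; apply.
  exact: Ccl (C'C _ C'c).
- move=> U oU.
  exists (~` (set_val @` (~` U))).
    apply: wC => c Cc; rewrite preimage_setC openC.
    have [D [finD DC' Dcov]] := cover c Cc.
    apply: (@eq_closed _ _ ((set_val : c -> S) @^-1`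
        (\bigcup_(d in D) (set_val @` (~` U) `&` d)))).
      apply/seteqP; split=> x /=.
        move=> [z Uz zx]; have [|d Dd dx] := Dcov (set_val x) (set_valP x).
          by rewrite -zx; exact: set_valP.
        by exists d => //; split=> //; exists z.
      by move=> [d _ []].
    have /continuous_closedP := @set_val_continuous S c; apply.
    apply: closed_bigcup => // d Dd.
    have oUd := oU (set_val @^-1` d) (ex_intro2 _ _ _ (DC' _ Dd) erefl).
    (* The trace of the complement of [U] on [d] extends to a closed [G] of [Z], then to a closed
       [G'] of [S]. As [d] lies in [Z], that trace is the intersection of [G'] and [d]. *)
    have [G clG UG] := closed_set_type (open_closedC oUd).
    have [G' clG' GG'] := closed_set_type clG.
    apply: (@eq_closed _ _ (G' `&` d)).
      apply/seteqP; split=> x [].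
        move=> [z nUz <-] dz; split=> //.
        have : ((set_val : (set_val @^-1` d : set Z) -> Z) @^-1` G)
            (exist _ z (mem_set dz)).
          by rewrite -UG.
        by rewrite GG'.
      move=> G'x dx; split=> //.
      have Zx : Z x by apply: (C'Z d) => //; exact: DC'.
      pose z : Z := exist _ x (mem_set Zx).
      exists z => // Uz.
      have : ((set_val : (set_val @^-1` d : set Z) -> Z) @^-1` G)
            (exist _ z (mem_set (dx : (set_val @^-1` d) z))).
        by rewrite GG'.
      by rewrite -UG; exact.
    by apply: closedI => //; exact: Ccl (C'C _ (DC' _ Dd)).
  apply/seteqP; split=> x /=.
    by apply: contra_notP => nUx; exists x.
  by move=> Ux [z nUz /val_inj zx]; apply: nUz; rewrite zx.
- move=> T f D finD DC covD fco.
  apply: set_type_continuous.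
  have [D' [finD' D'C' DD']] : exists D', [/\ finite_set D', D' `<=` C' &
      forall d, D d -> exists2 d', D' d' & d = set_val @^-1` d'].
    by apply: finite_choose => // _ /DC[d' C'd' <-]; exists d'.
  apply: (tC _ _ D' finD').
  + exact: subset_trans C'C.
  + move=> x; have [d Dd dfx] := covD x.
    by have [d' D'd' dd'] := DD' d Dd; exists d' => //; move: dfx; rewrite dd'.
  + exact: fco.
Qed.

End complexes.

(** * The complexes as spaces with barycentric coordinates *)

Section geometric_complexes.
Variable R : realType.

Lemma closedX (S T : topologicalType) (A : set S) (B : set T) :
  closed A -> closed B -> closed (A `*` B).
Proof.
move=> cA cB; apply: (@closedI _ (fst @^-1` A) (snd @^-1` B)).
- have /continuous_closedP : continuous (@fst S T) by move=> x; exact: cvg_fst.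
  exact.
- have /continuous_closedP : continuous (@snd S T) by move=> x; exact: cvg_snd.
  exact.
Qed.

Lemma geometric_simplex_closed (S : topologicalType) (V : choiceType)
    (t : V -> S -> R) (s : {fset V}) : (forall v, continuous (t v)) ->
  closed [set z | geometric_simplex s (t ^~ z)].
Proof.
move=> ct.
have -> : [set z | geometric_simplex s (t ^~ z)] =
    (\bigcap_v (t v @^-1` [set x | 0 <= x])) `&`
    (\bigcap_(v in [set v | v \notin s]) (t v @^-1` [set 0])) `&`
    ((fun z => \sum_(v <- s) t v z) @^-1` [set 1]).
  apply/seteqP; split=> z /=.
    move=> [t0 ts t1]; split; last exact: t1.
    by split=> v; [move=> _; exact: t0|exact: ts].
  move=> [[t0 ts] t1]; split; [move=> v; exact: t0|exact: ts|exact: t1].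
apply: closedI; first apply: closedI.
- apply: closed_bigI => v _.
  have /continuous_closedP := ct v; apply; exact: closed_ge.
- apply: closed_bigI => v _.
  have /continuous_closedP := ct v; apply; exact: closed_eq.
- have : continuous (fun z => \sum_(v <- s) t v z).
    by apply: continuous_big => // -[x y]; exact: add_continuous.
  by move=> /continuous_closedP; apply; exact: closed_eq.
Qed.

Lemma geometric_simplex_sub (V : choiceType) (s s' : {fset V}) (t : V -> R) :
  (forall v, v \notin s' -> t v = 0) -> (s' `<=` s)%fset ->
  geometric_simplex s t <-> geometric_simplex s' t.
Proof.
move=> ts' s's; have sumE : \sum_(v <- s) t v = \sum_(v <- s') t v.
  by symmetry; apply: big_fset_incl => // v _; exact: ts'.
split=> -[t0 ts t1]; split=> //.
- by rewrite -sumE.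
- by move=> v vs; apply: ts'; apply: contra vs; exact: (fsubsetP s's).
- by rewrite sumE.
Qed.

Lemma geometric_simplex_neq0 (V : choiceType) (s : {fset V}) (t : V -> R) :
  geometric_simplex s t -> s != fset0.
Proof.
move=> [_ _]; apply: contra_eqN => /eqP ->.
by rewrite big_seq_fset0 eq_sym oner_eq0.
Qed.

Lemma geometric_simplexI (V : choiceType) (s s' : {fset V}) (t : V -> R) :
  geometric_simplex s t -> geometric_simplex s' t ->
  geometric_simplex (s `&` s')%fset t.
Proof.
move=> st [_ ts' _]; apply/(geometric_simplex_sub _ (fsubsetIl s s')) => //.
move=> v; rewrite inE negb_and => /orP[|]; last exact: ts'.
by case: st => _ + _; apply.
Qed.

(** * Realizations *)

Section realization.
Variables (V : choiceType) (K : simplicial_complex V).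

Definition bary (p : realization R K) : V -> R :=
  set_val (p : realization_points R K).

Lemma bary_inj : injective bary.
Proof. by move=> p q pq; apply: val_inj. Qed.

Lemma bary_simplex (p : realization R K) :
  exists2 s, simplices K s & geometric_simplex s (bary p).
Proof.
by have [s Ks sp] := set_valP (p : realization_points R K); exists s.
Qed.

Lemma bary_surj (s : {fset V}) (t : V -> R) :
  simplices K s -> geometric_simplex s t -> exists p, bary p = t.
Proof.
move=> Ks st; have h : (\bigcup_(s in simplices K) geometric_simplex s) t.
  by exists s.
by exists (exist _ (t : {ptws V -> R}) (mem_set h)).
Qed.

Lemma ptws_continuous (T : topologicalType) (f : T -> {ptws V -> R}) :
  (forall v, continuous (fun x => f x v)) -> continuous f.
Proof.
move=> fc x; apply/cvg_sup => v.
move: x; apply/(@continuousP _ (initial_topology (fun g : V -> R => g v))).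
by move=> _ [B oB <-]; have /continuousP/(_ B oB) := fc v.
Qed.

Lemma ptws_eval_continuous (v : V) : continuous (fun f : {ptws V -> R} => f v).
Proof. exact: (@proj_continuous V (fun=> R) v). Qed.

(** Before retopologizing, the points carry the topology of pointwise convergence, for which the
    coordinates test continuity of any map; [coherent_complex] then applies. *)
Lemma realization_complex :
  cell_complex (fun v (p : realization R K) => bary p v)
    [set closed_simplex R K s | s in simplices K].
Proof.
have cco v : continuous (fun p : realization_points R K => set_val p v).
  exact: (@comp_continuous _ _ _ _ (fun f : {ptws V -> R} => f v)
            (@set_val_continuous _ _) (@ptws_eval_continuous v)).
apply: (@coherent_complex R (realization_points R K)) => //.
- by move=> _ [s _ <-]; exact: (geometric_simplex_closed cco).
- move=> T f D _ _ _ fco; apply: set_type_continuous.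
  by apply: ptws_continuous => v; exact: fco.
Qed.

End realization.

(** * Products and relational products *)

Section product.
Variables (V W : choiceType).
Variables (K : simplicial_complex V) (M : simplicial_complex W).

Definition product_coord (i : V + W) (z : realization R K * realization R M) :=
  match i with inl v => bary z.1 v | inr w => bary z.2 w end.

(** The topology being refined here is the product of two weak topologies, so continuity into it is
    checked on each factor, with the finite family of cells projected to that factor. *)
Lemma product_complex_cells :
  @cell_complex R (product_complex R K M) _ product_coord
    [set c | exists s t,
      [/\ simplices K s, simplices M t & c = closed_cell s t]].
Proof.
have [ccoK clK _ tK] := realization_complex K.
have [ccoM clM _ tM] := realization_complex M.
apply: coherent_complex.
- move=> [v|w].
    apply: (@comp_continuous _ _ _ fst (fun p : realization R K => bary p v)).
      by move=> p; exact: cvg_fst.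
    exact: ccoK.
  apply: (@comp_continuous _ _ _ snd (fun p : realization R M => bary p w)).
    by move=> p; exact: cvg_snd.
  exact: ccoM.
- move=> _ [s [t [Ks Mt ->]]]; apply: closedX; first by apply: clK; exists s.
  by apply: clM; exists t.
- move=> T f D finD DC covD fco.
  have -> : f = fun x => ((f x).1, (f x).2) by apply/funext => x; case: (f x).
  apply: pair_continuous.
    have [D' [finD' D'C cov']] : exists D', [/\ finite_set D',
        D' `<=` [set closed_simplex R K s | s in simplices K] &
        forall d, D d -> exists2 c, D' c & forall z, d z -> c z.1].
      apply: finite_choose => // _ /DC[s [t [Ks Mt ->]]].
      by exists (closed_simplex R K s); [exists s|move=> z []].
    apply: (tK _ _ D') => // [x|v]; last exact: (fco (inl v)).
    by have [d /cov'[c D'c dc] /dc cx] := covD x; exists c.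
  have [D' [finD' D'C cov']] : exists D', [/\ finite_set D',
      D' `<=` [set closed_simplex R M s | s in simplices M] &
      forall d, D d -> exists2 c, D' c & forall z, d z -> c z.2].
    apply: finite_choose => // _ /DC[s [t [Ks Mt ->]]].
    by exists (closed_simplex R M t); [exists t|move=> z []].
  apply: (tM _ _ D') => // [x|w]; last exact: (fco (inr w)).
  by have [d /cov'[c D'c dc] /dc cx] := covD x; exists c.
Qed.

Variable Q : face_relation K M.

Let relational_points : set (product_complex R K M) :=
  \bigcup_(p in related Q) closed_cell (set_val p.1) (set_val p.2).

(** A product cell over [s] and [t] meets a cell of the relational product in the cell over the
    intersected faces, which are still related by downward closure. As [s] and [t] have finitely
    many faces, [subcomplex] applies. *)
Lemma relational_complex :
  @cell_complex R (relational_product R Q) _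
    (fun i z => product_coord i (set_val (z : relational_points)))
    [set c | exists2 p, related Q p &
      c = [set z | closed_cell (set_val p.1) (set_val p.2)
                     (set_val (z : relational_points))]].
Proof.
have -> : [set c | exists2 p, related Q p &
      c = [set z | closed_cell (set_val p.1) (set_val p.2)
                     (set_val (z : relational_points))]] =
   [set set_val @^-1` c | c in
     [set (closed_cell (set_val p.1) (set_val p.2)
       : set (product_complex R K M)) | p in related Q]].
  apply/seteqP; split=> c /=.
    move=> [p Qp ->]; exists (closed_cell (set_val p.1) (set_val p.2)) => //.
    by exists p.
  by move=> [_ [p Qp <-] <-]; exists p.
apply: (subcomplex product_complex_cells).
- move=> _ [[s t] Qp <-] /=; exists (set_val s), (set_val t).
  by split=> //; [exact: (set_valP s)|exact: (set_valP t)].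
- by move=> _ [p Qp <-] z pz; exists p.
- move=> _ [s [t [Ks Mt ->]]].
  exists [set (closed_cell (set_val p.1) (set_val p.2)
       : set (product_complex R K M)) | p in
       related Q `&` [set p | set_val p.1 `<=` s /\ set_val p.2 `<=` t]%fset].
  split.
  + apply/finite_image.
    pose f (p : face K * face M) := (set_val p.1, set_val p.2).
    apply: (@sub_finite_set _ _
      (f @^-1` ([set` fpowerset s] `*` [set` fpowerset t]))).
      by move=> p [_ [ps pt]]; split; rewrite /= fpowersetE.
    apply: finite_preimage; last by apply: finite_setX; exact: finite_fset.
    by move=> [a b] [a' b'] _ _ [/val_inj -> /val_inj ->].
  + by move=> _ [p [Qp _] <-]; exists p.
  + move=> z [zs zt] [[s' t'] Qp [zs' zt']].
    have Ks' := simplices_sub (set_valP s') (fsubsetIr s _)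
      (geometric_simplex_neq0 (geometric_simplexI zs zs')).
    have Mt' := simplices_sub (set_valP t') (fsubsetIr t _)
      (geometric_simplex_neq0 (geometric_simplexI zt zt')).
    exists (closed_cell (s `&` set_val s')%fset (t `&` set_val t')%fset).
      pose a : face K := exist (fun u => u \in simplices K) _ (mem_set Ks').
      pose b : face M := exist (fun u => u \in simplices M) _ (mem_set Mt').
      exists (a, b) => //; split.
        by apply: related_down Qp => /=; exact: fsubsetIr.
      by split; exact: fsubsetIl.
    by split; exact: geometric_simplexI.
Qed.

End product.
End geometric_complexes.

(** * Shrinking and spreading a point of a simplex *)

Section weights.
Variables (R : realType) (V W : choiceType).

(** Summing over all of [I] avoids naming a simplex that contains the point; the value is meaningful
    for [u] of finite support. *)
Definition fsum (I : choiceType) (u : I -> R) := \sum_(i \in [set: I]) u i.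

Definition normalize (I : choiceType) (u : I -> R) (i : I) := u i / fsum u.

Lemma fsum_fset (I : choiceType) (s : {fset I}) (u : I -> R) :
  (forall i, i \notin s -> u i = 0) -> fsum u = \sum_(i <- s) u i.
Proof. exact: fsbigTE. Qed.

Lemma fsum_gt0 (I : choiceType) (s : {fset I}) (u : I -> R) :
  (forall i, 0 <= u i) -> (forall i, i \notin s -> u i = 0) ->
  (exists i, 0 < u i) -> 0 < fsum u.
Proof.
move=> u0 us [i ui]; rewrite (fsum_fset us).
have si : i \in s by apply: contraLR ui => /us ->; rewrite ltxx.
by rewrite (big_fsetD1 i si) /= ltr_pwDl// sumr_ge0.
Qed.

Lemma normalize_simplex (I : choiceType) (s : {fset I}) (u : I -> R) :
  (forall i, 0 <= u i) -> (forall i, i \notin s -> u i = 0) ->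
  (exists i, 0 < u i) -> geometric_simplex s (normalize u).
Proof.
move=> u0 us ui; have tu := fsum_gt0 u0 us ui; split.
- by move=> i; rewrite divr_ge0// ltW.
- by move=> i /us ui0; rewrite /normalize ui0 mul0r.
- by rewrite -mulr_suml -(fsum_fset us) divff// gt_eqF.
Qed.

(* Any continuous threshold lying strictly between 0 and the largest coordinate
   would do; this one is polynomial in the coordinates. *)
Definition level (t : V -> R) := 2^-1 * fsum (fun v => t v ^+ 2).

Definition excess (t : V -> R) (v : V) := Num.max 0 (t v - level t).

(* The second factor vanishes as soon as [rho] misses a vertex whose coordinate
   exceeds the level, and the first one as soon as [rho] is not contained in the
   support of [t]. *)
Definition weight (t : V -> R) (rho : {fset V}) :=
  \prod_(v <- rho) t v *
  Num.max 0 (\sum_(v <- rho) t v - (1 - level t)).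

Definition mass (sel : {fset V} -> {fset W}) (t : V -> R) (w : W) :=
  fsum (fun rho => weight t rho * (w \in sel rho)%:R).

Section simplex.
Variables (s : {fset V}) (t : V -> R).
Hypothesis st : geometric_simplex s t.

Let t0 v : 0 <= t v. Proof. by case: st. Qed.
Let ts v : v \notin s -> t v = 0. Proof. by case: st => _ + _; apply. Qed.
Let t1 : \sum_(v <- s) t v = 1. Proof. by case: st. Qed.

Lemma levelE : level t = 2^-1 * \sum_(v <- s) t v ^+ 2.
Proof. by rewrite /level (@fsum_fset _ s)// => v /ts ->; rewrite expr0n. Qed.

Lemma simplex_sum_le (r : {fset V}) : \sum_(v <- r) t v <= 1.
Proof.
have rE : \sum_(v <- (s `|` r)%fset) t v = 1.
  rewrite -t1; symmetry; apply: big_fset_incl; first exact: fsubsetUl.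
  by move=> v _; exact: ts.
rewrite -rE (big_fsetID _ (mem r) (s `|` r)%fset) /=.
have -> : [fset x in s `|` r | x \in mem r]%fset = r.
  by apply/fsetP => v; rewrite !inE/=; case: (v \in r); rewrite ?orbT ?andbF.
by rewrite lerDl sumr_ge0.
Qed.

Lemma simplex_pos : exists2 v, v \in s & 0 < t v.
Proof.
apply: contrapT => h; have := oner_neq0 R.
rewrite -t1 big_seq big1 ?eqxx// => v vs.
apply/eqP; rewrite eq_le t0 andbT leNgt.
by apply/negP => tv; apply: h; exists v.
Qed.

Lemma level_gt0 : 0 < level t.
Proof.
have [v _ tv] := simplex_pos.
rewrite mulr_gt0 ?invr_gt0 ?ltr0n//; apply: (@fsum_gt0 _ s).
- by move=> i; rewrite sqr_ge0.
- by move=> i /ts ->; rewrite expr0n.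
- by exists v; rewrite exprn_gt0.
Qed.

(* If no coordinate exceeded [level t], then [sum t_v^2 <= level t] would be
   at most half of itself. *)
Lemma exists_above_level : exists2 v, v \in s & level t < t v.
Proof.
apply: contrapT => h; have l0 := level_gt0.
have : \sum_(v <- s) t v ^+ 2 <= \sum_(v <- s) level t * t v.
  rewrite big_seq [leRHS]big_seq ler_sum// => v vs.
  rewrite expr2 ler_wpM2r// leNgt; apply/negP => tv; apply: h; exists v => //.
rewrite -mulr_sumr t1 mulr1; have := levelE; move: l0; lra.
Qed.

Lemma above_level_in v : level t < t v -> v \in s.
Proof.
by move=> lt; apply: contraLR lt => /ts ->; rewrite -leNgt ltW// level_gt0.
Qed.

Lemma weight_ge0 rho : 0 <= weight t rho.
Proof. by rewrite mulr_ge0 ?prodr_ge0// le_max lexx. Qed.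

Lemma weight_sub rho : weight t rho != 0 -> (rho `<=` s)%fset.
Proof.
rewrite mulf_eq0 negb_or => /andP[+ _] => pt.
apply/fsubsetP => v vr; apply: contraNT pt => /ts tv.
by rewrite (big_fsetD1 v vr) /= tv mul0r.
Qed.

(** With [v] adjoined, the coordinates over [rho] still sum to at most 1. If [v] were missing, the
    sum over [rho] would thus be below [1 - level t], and the second factor 0. *)
Lemma weight_above rho v : weight t rho != 0 -> level t < t v -> v \in rho.
Proof.
rewrite mulf_eq0 negb_or => /andP[_ mx] lt; apply: contraNT mx => vr.
rewrite eq_le le_max lexx andbT ge_max lexx /=.
have := simplex_sum_le (v |` rho)%fset; rewrite (big_fsetU1 _ _ vr) /=.
move: lt; lra.
Qed.

(** The support of [t] works: its coordinates are positive and sum to 1, so the second factor is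
    [level t]. *)
Lemma exists_weight :
  exists2 rho, (rho `<=` s)%fset & 0 < weight t rho.
Proof.
pose rho := [fset v in s | t v != 0]%fset; have rs : (rho `<=` s)%fset.
  by apply/fsubsetP => v; rewrite !inE => /andP[].
exists rho => //.
have r1 : \sum_(v <- rho) t v = 1.
  rewrite -t1; apply: big_fset_incl => // v vs; rewrite !inE vs /= negbK.
  by move/eqP.
rewrite /weight r1 mulr_gt0//; last first.
  by rewrite lt_max; apply/orP; right; have := level_gt0; lra.
rewrite big_seq prodr_gt0// => v; rewrite !inE => /andP[_ tv].
by rewrite lt_neqAle eq_sym tv t0.
Qed.

Lemma shrink_simplex (r : {fset V}) :
  (forall v, level t < t v -> v \in r) ->
  geometric_simplex r (normalize (excess t)).
Proof.
move=> hr; apply: normalize_simplex.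
- by move=> v; rewrite le_max lexx.
- move=> v vr; apply/max_idPl; rewrite subr_le0 leNgt.
  by apply: contra vr; exact: hr.
- have [v _ tv] := exists_above_level; exists v.
  by rewrite lt_max subr_gt0 tv orbT.
Qed.

(** Makes the sum in [mass] finite, uniformly on the simplex [s]. *)
Lemma mass_terms (sel : {fset V} -> {fset W}) w rho :
  rho \notin fpowerset s -> weight t rho * (w \in sel rho)%:R = 0.
Proof.
rewrite fpowersetE => h; have [->|/weight_sub] := eqVneq (weight t rho) 0.
  by rewrite mul0r.
by rewrite (negPf h).
Qed.

Lemma mass_ge0 (sel : {fset V} -> {fset W}) w : 0 <= mass sel t w.
Proof.
rewrite /mass (fsum_fset (@mass_terms sel w)) sumr_ge0// => rho _.
by rewrite mulr_ge0 ?weight_ge0.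
Qed.

Lemma mass_out (sel : {fset V} -> {fset W}) (r : {fset W}) w :
  (forall rho, weight t rho != 0 -> (sel rho `<=` r)%fset) ->
  w \notin r -> mass sel t w = 0.
Proof.
move=> selr wr; rewrite /mass /fsum fsbig1// => rho _.
have [->|/selr/fsubsetP sr] := eqVneq (weight t rho) 0; first by rewrite mul0r.
have [/sr|_] := boolP (w \in sel rho); first by rewrite (negPf wr).
by rewrite mulr0.
Qed.

(** A set of positive weight contains the vertices above the level, so it is nonempty and [sel]
    provides a vertex for it. *)
Lemma mass_gt0 (sel : {fset V} -> {fset W}) :
  (forall rho, rho != fset0 -> (rho `<=` s)%fset -> sel rho != fset0) ->
  exists w, 0 < mass sel t w.
Proof.
move=> sel0; have [rho rs wr] := exists_weight.
have [v _ tv] := exists_above_level.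
have r0 : rho != fset0.
  by apply/fset0Pn; exists v; apply: weight_above tv; rewrite gt_eqF.
have /fset0Pn[w wsel] := sel0 _ r0 rs; exists w.
apply: fsum_gt0 (@mass_terms sel w) _ => [rho'|].
  by rewrite mulr_ge0 ?weight_ge0.
by exists rho; rewrite wsel mulr1.
Qed.

Lemma spread_simplex (sel : {fset V} -> {fset W}) (r : {fset W}) :
  (forall rho, rho != fset0 -> (rho `<=` s)%fset -> sel rho != fset0) ->
  (forall rho, weight t rho != 0 -> (sel rho `<=` r)%fset) ->
  geometric_simplex r (normalize (mass sel t)).
Proof.
move=> sel0 selr; apply: normalize_simplex; last exact: mass_gt0.
- exact: mass_ge0.
- by move=> w; exact: mass_out.
Qed.

End simplex.
End weights.

(** * Continuity of shrinking and spreading *)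

Section continuity.
Variables (R : realType) (V W : choiceType) (K : simplicial_complex V).

Lemma bary_continuous v : continuous (fun p : realization R K => bary p v).
Proof. exact: coordinates_continuous (realization_complex R K) v. Qed.

Lemma mulr_continuous (T : topologicalType) (f g : T -> R) :
  continuous f -> continuous g -> continuous (fun x => f x * g x).
Proof. by move=> cf cg x; apply: cvgM; [exact: cf|exact: cg]. Qed.

Lemma addr_continuous (T : topologicalType) (f g : T -> R) :
  continuous f -> continuous g -> continuous (fun x => f x + g x).
Proof. by move=> cf cg x; apply: cvgD; [exact: cf|exact: cg]. Qed.

Lemma subr_continuous (T : topologicalType) (f g : T -> R) :
  continuous f -> continuous g -> continuous (fun x => f x - g x).
Proof. by move=> cf cg x; apply: cvgB; [exact: cf|exact: cg]. Qed.

Lemma cst_continuous (T : topologicalType) (a : R) :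
  continuous (fun _ : T => a).
Proof. by move=> x; exact: cvg_cst. Qed.

Lemma invr_continuous (T : topologicalType) (f : T -> R) :
  (forall x, f x != 0) -> continuous f -> continuous (fun x => (f x)^-1).
Proof. by move=> f0 cf x; apply: cvgV; [exact: f0|exact: cf]. Qed.

Lemma sum_continuous (T : topologicalType) (I : Type) (s : seq I)
    (F : I -> T -> R) : (forall i, continuous (F i)) ->
  continuous (fun x => \sum_(i <- s) F i x).
Proof.
by move=> cF; apply: continuous_big => // -[x y]; exact: add_continuous.
Qed.

Lemma prod_continuous (T : topologicalType) (I : Type) (s : seq I)
    (F : I -> T -> R) : (forall i, continuous (F i)) ->
  continuous (fun x => \prod_(i <- s) F i x).
Proof.
by move=> cF; apply: continuous_big => // -[x y]; exact: mul_continuous.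
Qed.

(** On each closed simplex this is a sum over a fixed finite set, and the weak topology glues these
    restrictions. *)
Lemma fsum_continuous (I : choiceType) (F : I -> realization R K -> R) :
  (forall i, continuous (F i)) ->
  (forall s, simplices K s -> exists A : {fset I}, forall p,
    geometric_simplex s (bary p) -> forall i, i \notin A -> F i p = 0) ->
  continuous (fun p => fsum (F ^~ p)).
Proof.
move=> cF supp.
apply: (weak_continuous (cells_weak (realization_complex R K))).
move=> _ [s /supp[A FA] <-].
have -> : (fun p => fsum (F ^~ p)) \o
    (set_val : closed_simplex R K s -> realization R K) =
    fun p => \sum_(i <- A) F i (set_val p).
  by apply/funext => p /=; apply: fsum_fset; apply: FA; exact: (set_valP p).
apply: sum_continuous => i.
exact: (comp_continuous (@set_val_continuous _ _) (cF i)).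
Qed.

Lemma level_continuous : continuous (fun p : realization R K => level (bary p)).
Proof.
apply: mulr_continuous; first exact: cst_continuous.
apply: (fsum_continuous (F := fun v p => bary p v ^+ 2)) => [v|s _].
  exact: (mulr_continuous (@bary_continuous v) (@bary_continuous v)).
by exists s => p [_ ps _] v /ps ->; rewrite expr0n.
Qed.

Lemma excess_continuous v :
  continuous (fun p : realization R K => excess (bary p) v).
Proof.
apply: max_fun_continuous; first exact: cst_continuous.
by apply: subr_continuous; [exact: bary_continuous|exact: level_continuous].
Qed.

Lemma weight_continuous rho :
  continuous (fun p : realization R K => weight (bary p) rho).
Proof.
apply: mulr_continuous; first by apply: prod_continuous; exact: bary_continuous.
apply: max_fun_continuous; first exact: cst_continuous.
apply: subr_continuous; first by apply: sum_continuous; exact: bary_continuous.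
by apply: subr_continuous; [exact: cst_continuous|exact: level_continuous].
Qed.

Lemma mass_continuous (sel : {fset V} -> {fset W}) w :
  continuous (fun p : realization R K => mass sel (bary p) w).
Proof.
apply: (fsum_continuous
  (F := fun rho p => weight (bary p) rho * (w \in sel rho)%:R)) => [rho|s _].
  by apply: mulr_continuous; [exact: weight_continuous|exact: cst_continuous].
by exists (fpowerset s) => p sp rho; exact: mass_terms sp _ _ _.
Qed.

Lemma normalize_continuous (I : choiceType) (u : realization R K -> I -> R) i :
  (forall i, continuous (fun p => u p i)) ->
  (forall p i, 0 <= u p i) -> (forall p, exists i, 0 < u p i) ->
  (forall s, simplices K s -> exists A : {fset I}, forall p,
    geometric_simplex s (bary p) -> forall i, i \notin A -> u p i = 0) ->
  continuous (fun p => normalize (u p) i).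
Proof.
move=> cu u0 up supp; apply: mulr_continuous => //; apply: invr_continuous.
  move=> p; have [s /supp[A uA] sp] := bary_simplex p.
  by rewrite gt_eqF// (fsum_gt0 (u0 p) (uA p sp) (up p)).
exact: (fsum_continuous (F := fun i p => u p i)).
Qed.

Lemma shrink_continuous v :
  continuous (fun p : realization R K => normalize (excess (bary p)) v).
Proof.
apply: normalize_continuous => [w|p w|p|s _].
- exact: excess_continuous.
- by rewrite le_max lexx.
- have [s _ sp] := bary_simplex p.
  have [w _ pw] := exists_above_level sp; exists w.
  by rewrite lt_max subr_gt0 pw orbT.
- exists s => p sp w ws; apply/max_idPl; rewrite subr_le0 leNgt.
  by apply: contra ws; exact: above_level_in.
Qed.

Lemma spread_continuous (sel : {fset V} -> {fset W}) w :
  (forall s, simplices K s -> sel s != fset0) ->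
  continuous (fun p : realization R K => normalize (mass sel (bary p)) w).
Proof.
move=> sel0; apply: normalize_continuous => [x|p x|p|s Ks].
- exact: mass_continuous.
- have [s _ sp] := bary_simplex p; exact: (mass_ge0 sp).
- have [s Ks sp] := bary_simplex p; apply: (mass_gt0 sp) => rho r0 rs.
  by apply: sel0; exact: simplices_sub Ks rs r0.
- exists (\bigcup_(rho <- fpowerset s) sel rho)%fset => p sp x xs.
  apply: (mass_out _ xs) => rho /(weight_sub sp) rs; apply: bigfcup_sup => //.
  by rewrite fpowersetE.
Qed.

End continuity.

(** * The homotopy equivalence *)

Section mixing.
Variable R : realType.

Definition mix (I : Type) (c : R) (f g : I -> R) (i : I) :=
  (1 - c) * f i + c * g i.

Lemma mix0 I (f g : I -> R) : mix 0 f g = f.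
Proof. by apply/funext => i; rewrite /mix subr0 mul1r mul0r addr0. Qed.

Lemma mix1 I (f g : I -> R) : mix 1 f g = g.
Proof. by apply/funext => i; rewrite /mix subrr mul1r mul0r add0r. Qed.

Lemma mix_simplex (V : choiceType) (s : {fset V}) c (f g : V -> R) :
  0 <= c <= 1 -> geometric_simplex s f -> geometric_simplex s g ->
  geometric_simplex s (mix c f g).
Proof.
move=> /andP[c0 c1] [f0 fs f1] [g0 gs g1]; split.
- by move=> v; rewrite addr_ge0// mulr_ge0// subr_ge0.
- by move=> v vs; rewrite /mix fs// gs// !mulr0 addr0.
- by rewrite big_split /= -!mulr_sumr f1 g1 !mulr1 subrK.
Qed.

Lemma mix_continuous (T : topologicalType) (I : Type) (c : T -> R)
    (f g : T -> I -> R) i : continuous c ->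
  continuous (fun x => f x i) -> continuous (fun x => g x i) ->
  continuous (fun x => mix (c x) (f x) (g x) i).
Proof.
move=> cc cf cg; apply: addr_continuous; apply: mulr_continuous => //.
by apply: subr_continuous => //; exact: cst_continuous.
Qed.

Lemma fst_val_continuous (S T : topologicalType) (c : set S) (f : S -> T) :
  continuous f -> continuous (fun p : c * R => f (set_val p.1)).
Proof.
move=> cf; apply: (@comp_continuous _ _ _ fst (fun x : c => f (set_val x))).
  by move=> p; exact: cvg_fst.
exact: (comp_continuous (@set_val_continuous _ _) cf).
Qed.

Lemma snd_continuous (T : topologicalType) : continuous (@snd T R).
Proof. by move=> p; exact: cvg_snd. Qed.

(** Homotopies are functions on the whole of [S * R]; clamping the time keeps convex combinations
    inside their simplex at every time. *)
Definition clamp (x : R) := Num.max 0 (Num.min 1 x).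

Lemma clamp_itv x : 0 <= clamp x <= 1.
Proof. by rewrite le_max lexx ge_max ler01 ge_min lexx. Qed.

Lemma clamp_le0 x : x <= 0 -> clamp x = 0.
Proof. by move=> x0; apply/max_idPl; rewrite ge_min x0 orbT. Qed.

Lemma clamp_ge1 x : 1 <= x -> clamp x = 1.
Proof. by move=> x1; rewrite /clamp (min_idPl x1); apply/max_idPr. Qed.

Lemma clamp_continuous (T : topologicalType) (f : T -> R) :
  continuous f -> continuous (fun x => clamp (f x)).
Proof.
move=> cf; apply: max_fun_continuous; first exact: cst_continuous.
by apply: min_fun_continuous => //; exact: cst_continuous.
Qed.

End mixing.

(** * Simplices containing the spread points *)

Section fan.
Variables (V W : choiceType) (sel : {fset V} -> {fset W}).

(** With [rho] the vertices above the level, this set carries both a point of the simplex [t] and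
    the spread point. Only finitely many such sets arise from given [s] and [t]. *)
Definition fan (s : {fset V}) (t : {fset W}) (rho : {fset V}) : {fset W} :=
  (t `|` \bigcup_(u <- fpowerset s | rho `<=` u) sel u)%fset.

Lemma fan_sub s t rho u : (rho `<=` u)%fset -> (u `<=` s)%fset ->
  (sel u `<=` fan s t rho)%fset.
Proof.
move=> ru us; apply: fsubset_trans (fsubsetUr _ _).
by apply: bigfcup_sup => //; rewrite fpowersetE.
Qed.

Lemma fanP s t rho w : w \in fan s t rho ->
  w \in t \/ exists u, [/\ (rho `<=` u)%fset, (u `<=` s)%fset & w \in sel u].
Proof.
rewrite in_fsetU => /orP[->|]; first by left.
by move=> /bigfcupP[u /andP[]]; rewrite fpowersetE; right; exists u.
Qed.

End fan.

(** * The projection to one Dowker complex *)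

Section dowker_equivalence.
Variables (R : realType) (V W : choiceType) (K : simplicial_complex V).
Variable r : V -> W -> Prop.
Hypothesis KP : forall s, simplices K s <->
  s != fset0 /\ exists w, forall v, v \in s -> r v w.

Variables (Z : topologicalType) (pr : Z -> realization R K) (q : Z -> W -> R).

Definition full (s : {fset V}) (t : {fset W}) :=
  [/\ s != fset0, t != fset0 & forall v w, v \in s -> w \in t -> r v w].

Definition cell (s : {fset V}) (t : {fset W}) : set Z :=
  [set z | geometric_simplex s (bary (pr z)) /\ geometric_simplex t (q z)].

Definition pair_coord (i : V + W) (z : Z) : R :=
  match i with inl v => bary (pr z) v | inr w => q z w end.

Hypothesis Zcells : cell_complex pair_coord
  [set c | exists s t, full s t /\ c = cell s t].
Hypothesis Zcover : forall z, exists s t, full s t /\ cell s t z.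
Hypothesis Zpair : forall s t f g, full s t -> geometric_simplex s f ->
  geometric_simplex t g -> exists z, bary (pr z) = f /\ q z = g.
Hypothesis Zinj : forall z z',
  bary (pr z) = bary (pr z') -> q z = q z' -> z = z'.

Lemma full_simplex s t : full s t -> simplices K s.
Proof.
move=> [s0 /fset0Pn[w wt] st]; apply/KP; split=> //.
by exists w => v /st; apply.
Qed.

(** Each cell is mapped into a single closed simplex, where the coordinates test continuity. *)
Lemma pr_continuous : continuous pr.
Proof.
apply: (weak_continuous (cells_weak Zcells)) => _ [s [t [st ->]]].
apply: (cells_tests (realization_complex R K)
  (D := [set closed_simplex R K s])).
- exact: finite_set1.
- by move=> _ ->; exists s => //; exact: full_simplex st.
- by move=> z; exists (closed_simplex R K s) => //; have [] := set_valP z.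
- move=> v; exact: (@comp_continuous _ _ _ set_val (pair_coord (inl v))
    (@set_val_continuous _ _) (coordinates_continuous Zcells (i := inl v))).
Qed.

Lemma q_continuous w : continuous (fun z => q z w).
Proof. exact: (coordinates_continuous Zcells (i := inr w)). Qed.

Variable sel : {fset V} -> {fset W}.
Hypothesis selP : forall s, simplices K s ->
  sel s != fset0 /\ forall v w, v \in s -> w \in sel s -> r v w.

Definition core (s : {fset V}) (f : V -> R) :=
  [fset v in s | level f < f v]%fset.

Local Notation shrink p := (normalize (excess (bary p))).
Local Notation spread p := (normalize (mass sel (bary p))).

(** A vertex of [rho] is related to [t] because it lies in [s], and to each [sel u] in the fan
    because it lies in [u]. The fan is nonempty since it contains [sel s]. *)
Lemma fan_full s t rho : simplices K s ->
  (forall v w, v \in s -> w \in t -> r v w) ->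
  (rho `<=` s)%fset -> rho != fset0 -> full rho (fan sel s t rho).
Proof.
move=> Ks st rs r0; split=> //.
  have /fset0Pn[w ws] := (selP Ks).1; apply/fset0Pn; exists w.
  exact: (fsubsetP (fan_sub sel t rs (fsubset_refl s))).
move=> v w vr /fanP[|[u [ru us wu]]]; first by apply: st; exact: (fsubsetP rs).
have Ku : simplices K u.
  apply: simplices_sub Ks us _; apply/fset0Pn; exists v; exact: (fsubsetP ru).
by apply: (selP Ku).2 wu; exact: (fsubsetP ru).
Qed.

(** The finite test family for the first half of the homotopy on [cell s t]; with [t] empty, for the
    homotopy inverse on the simplex [s]. *)
Definition fan_cells (s : {fset V}) (t : {fset W}) : set (set Z) :=
  [set cell rho (fan sel s t rho) |
    rho in [set rho | (rho `<=` s)%fset /\ rho != fset0]].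

Lemma fan_cells_finite s t : finite_set (fan_cells s t).
Proof.
apply/finite_image; apply: (@sub_finite_set _ _ [set` fpowerset s]).
  by move=> rho [rs _]; rewrite /= fpowersetE.
exact: finite_fset.
Qed.

Lemma fan_cells_full s t : simplices K s ->
  (forall v w, v \in s -> w \in t -> r v w) ->
  fan_cells s t `<=` [set c | exists s t, full s t /\ c = cell s t].
Proof.
move=> Ks st _ [rho [rs r0] <-]; exists rho, (fan sel s t rho); split=> //.
exact: fan_full.
Qed.

Section point.
Variables (s : {fset V}) (p : realization R K).
Hypotheses (Ks : simplices K s) (sp : geometric_simplex s (bary p)).

Lemma core_sub : (core s (bary p) `<=` s)%fset.
Proof. by apply/fsubsetP => v; rewrite !inE => /andP[]. Qed.

Lemma core_neq0 : core s (bary p) != fset0.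
Proof.
have [v vs pv] := exists_above_level sp.
by apply/fset0Pn; exists v; rewrite !inE vs.
Qed.

Lemma shrink_core : geometric_simplex (core s (bary p)) (shrink p).
Proof.
by apply: (shrink_simplex sp) => v pv; rewrite !inE pv (above_level_in sp).
Qed.

Lemma shrink_in : geometric_simplex s (shrink p).
Proof. by apply: (shrink_simplex sp) => v; exact: above_level_in. Qed.

(** Every [rho] of nonzero weight lies between the core and [s], so its [sel rho] is one of the sets
    united in the fan. *)
Lemma spread_fan t :
  geometric_simplex (fan sel s t (core s (bary p))) (spread p).
Proof.
apply: (spread_simplex sp) => rho.
  by move=> r0 rs; exact: (selP (simplices_sub Ks rs r0)).1.
move=> wr; apply: fan_sub; last exact: (weight_sub sp wr).
by apply/fsubsetP => v; rewrite !inE => /andP[_]; exact: (weight_above sp wr).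
Qed.

End point.

Lemma section_exists (p : realization R K) :
  exists z, bary (pr z) = shrink p /\ q z = spread p.
Proof.
have [s Ks sp] := bary_simplex p.
apply: (@Zpair (core s (bary p)) (fan sel s fset0 (core s (bary p)))).
- by apply: fan_full;
    [|move=> v w; rewrite inE|exact: core_sub|exact: core_neq0].
- exact: shrink_core.
- exact: spread_fan.
Qed.

(* For [x <= 1/2] the first component stays at its shrunk value while the second
   one moves; for [x >= 1/2] the second component is [q z] while the first one
   moves. The supports thus stay related throughout. *)
Definition homotopy_coord (z : Z) (x : R) :=
  (mix (clamp (x *+ 2 - 1)) (shrink (pr z)) (bary (pr z)),
   mix (clamp (x *+ 2)) (spread (pr z)) (q z)).

(** The last clause confines the tracks of all points of [cell s t] to one finite family of cells,
    as [cells_tests] demands. *)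
Lemma homotopy_cell s t z x : full s t -> cell s t z ->
  exists s' t', [/\ full s' t',
    geometric_simplex s' (homotopy_coord z x).1,
    geometric_simplex t' (homotopy_coord z x).2 &
    (cell s t |` fan_cells s t) (cell s' t')].
Proof.
move=> st [zs zt]; have Ks := full_simplex st; have [s0 t0 rst] := st.
have [x2|x2] := leP x (2^-1).
  pose rho := core s (bary (pr z)).
  exists rho, (fan sel s t rho); split.
  - by apply: fan_full => //; [exact: core_sub|exact: core_neq0].
  - rewrite /= clamp_le0 ?mix0; last by lra.
    exact: shrink_core.
  - apply: mix_simplex; first exact: clamp_itv.
      exact: spread_fan.
    apply/(geometric_simplex_sub _ (fsubsetUl _ _)) => //; by case: zt.
  - right; exists rho => //; split; [exact: core_sub|exact: core_neq0].
exists s, t; split=> //.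
- by apply: mix_simplex => //; [exact: clamp_itv|exact: shrink_in].
- by rewrite /= clamp_ge1 ?mix1//; lra.
- by left.
Qed.

Lemma homotopy_equivalent_choice :
  homotopy_equivalent R (realization R K) Z /\
  homotopy_equivalent R Z (realization R K).
Proof.
have sel0 s : simplices K s -> sel s != fset0 by move=> /selP[].
(* [f] is the homotopy inverse of [pr], with components [shrink] and [spread]. *)
have /choice[f fP] := section_exists.
have cf : continuous f.
  apply: (weak_continuous (cells_weak (realization_complex R K))).
  move=> _ [s Ks <-].
  apply: (cells_tests Zcells (D := fan_cells s fset0)).
  - exact: fan_cells_finite.
  - by apply: fan_cells_full => // v w; rewrite inE.
  - move=> p; have sp : geometric_simplex s (bary (set_val p)) := set_valP p.
    pose rho := core s (bary (set_val p)).
    exists (cell rho (fan sel s fset0 rho)).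
      by exists rho => //; split; [exact: core_sub|exact: core_neq0].
    have [f1 f2] := fP (set_val p).
    by split; rewrite ?f1 ?f2; [exact: shrink_core|exact: spread_fan].
  - move=> [v|w].
      have -> : pair_coord (inl v) \o (f \o set_val) =
          (fun p => shrink p v) \o (set_val : closed_simplex R K s -> _).
        by apply/funext => p /=; rewrite (fP _).1.
      exact: (comp_continuous (@set_val_continuous _ _)
        (@shrink_continuous _ _ _ v)).
    have -> : pair_coord (inr w) \o (f \o set_val) =
        (fun p => spread p w) \o (set_val : closed_simplex R K s -> _).
      by apply/funext => p /=; rewrite (fP _).2.
    exact: (comp_continuous (@set_val_continuous _ _)
      (@spread_continuous _ _ _ _ _ w sel0)).
have cpr := pr_continuous.
(* The segment from the shrunk point to the point stays in any simplex containing the point, so one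
   cell tests continuity. *)
have hK : homotopic R (pr \o f) idfun.
  have Hex (px : realization R K * R) : exists p' : realization R K,
      bary p' = mix (clamp px.2) (shrink px.1) (bary px.1).
    case: px => [p x] /=; have [s Ks sp] := bary_simplex p.
    apply: (bary_surj Ks); apply: mix_simplex => //; first exact: clamp_itv.
    exact: shrink_in.
  have [H HP] := choice Hex; exists H; split.
  - apply: continuous_subspaceT.
    apply: (weak_prod_continuous (cells_weak (realization_complex R K))).
      move=> p; have [s Ks sp] := bary_simplex p.
      by exists (closed_simplex R K s) => //; exists s.
    move=> _ [s Ks <-].
    apply: (cells_tests (realization_complex R K)
      (D := [set closed_simplex R K s])).
    + exact: finite_set1.
    + by move=> _ ->; exists s.
    + move=> [p x]; exists (closed_simplex R K s) => //.
      have sp : geometric_simplex s (bary (set_val p)) := set_valP p.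
      rewrite /closed_simplex /= -/(bary _) HP.
      by apply: mix_simplex => //; [exact: clamp_itv|exact: shrink_in].
    + move=> v; have -> : (fun p : realization R K => bary p v) \o
          (fun p : closed_simplex R K s * R => H (set_val p.1, p.2)) =
          fun p => mix (clamp p.2) (shrink (set_val p.1))
                       (bary (set_val p.1)) v.
        by apply/funext => p /=; rewrite HP.
      apply: mix_continuous.
      * exact: clamp_continuous (@snd_continuous _ _).
      * exact: fst_val_continuous (@shrink_continuous _ _ _ v).
      * exact: fst_val_continuous (@bary_continuous R V K v).
  - by move=> p; apply: bary_inj; rewrite HP /= clamp_le0// mix0 (fP p).1.
  - by move=> p; apply: bary_inj; rewrite HP /= clamp_ge1// mix1.
(* Here the track of a cell leaves that cell, and the family of [homotopy_cell] is used instead. *)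
have hZ : homotopic R (f \o pr) idfun.
  have Hex (zx : Z * R) : exists z',
      bary (pr z') = (homotopy_coord zx.1 zx.2).1 /\
      q z' = (homotopy_coord zx.1 zx.2).2.
    case: zx => [z x]; have [s [t [st zst]]] := Zcover z.
    have [s' [t' [st' h1 h2 _]]] := homotopy_cell x st zst.
    exact: Zpair h1 h2.
  have [H HP] := choice Hex; exists H; split.
  - apply: continuous_subspaceT.
    apply: (weak_prod_continuous (cells_weak Zcells)).
      move=> z; have [s [t [st zst]]] := Zcover z.
      by exists (cell s t) => //; exists s, t.
    move=> _ [s [t [st ->]]].
    apply: (cells_tests Zcells (D := cell s t |` fan_cells s t)).
    + rewrite finite_setU; split; first exact: finite_set1.
      exact: fan_cells_finite.
    + move=> c [->|]; first by exists s, t.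
      by apply: fan_cells_full; [exact: full_simplex st|case: st].
    + move=> [z x].
      have [s' [t' [_ h1 h2 Dst]]] := homotopy_cell x st (set_valP z).
      exists (cell s' t') => //; have [H1 H2] := HP (set_val z, x).
      by split; rewrite ?H1 ?H2.
    + have c2 : continuous (fun p : cell s t * R => p.2 *+ 2).
        exact: addr_continuous (@snd_continuous _ _) (@snd_continuous _ _).
      move=> [v|w].
        have -> : pair_coord (inl v) \o
            (fun p : cell s t * R => H (set_val p.1, p.2)) =
            fun p => (homotopy_coord (set_val p.1) p.2).1 v.
          by apply/funext => p /=; rewrite (HP _).1.
        apply: mix_continuous.
        * apply: clamp_continuous; apply: subr_continuous => //.
          exact: cst_continuous.
        * apply: (@fst_val_continuous R Z R (cell s t)
            (fun z => shrink (pr z) v)).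
          exact: (comp_continuous cpr (@shrink_continuous _ _ _ v)).
        * exact: fst_val_continuous
            (coordinates_continuous Zcells (i := inl v)).
      have -> : pair_coord (inr w) \o
          (fun p : cell s t * R => H (set_val p.1, p.2)) =
          fun p => (homotopy_coord (set_val p.1) p.2).2 w.
        by apply/funext => p /=; rewrite (HP _).2.
      apply: mix_continuous.
      * exact: clamp_continuous c2.
      * apply: (@fst_val_continuous R Z R (cell s t)
          (fun z => spread (pr z) w)).
        exact: (comp_continuous cpr (@spread_continuous _ _ _ _ _ w sel0)).
      * exact: fst_val_continuous (@q_continuous w).
  - move=> z; apply: Zinj; rewrite ?(HP _).1 ?(HP _).2 /= ?(fP _).1 ?(fP _).2.
      by rewrite clamp_le0 ?mix0//; lra.
    by rewrite clamp_le0 ?mix0// mul0rn.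
  - move=> z; apply: Zinj; rewrite ?(HP _).1 ?(HP _).2 /=.
      by rewrite clamp_ge1 ?mix1//; lra.
    by rewrite clamp_ge1 ?mix1//; lra.
by split; [exists f, pr|exists pr, f].
Qed.

End dowker_equivalence.

(** The space [Z] is abstract, known through its first projection and its second coordinates, so
    that the result applies to the relational product with the factors in either order. *)
Lemma dowker_homotopy_equivalent (R : realType) (V W : choiceType)
    (K : simplicial_complex V) (r : V -> W -> Prop)
    (Z : topologicalType) (pr : Z -> realization R K) (q : Z -> W -> R) :
  (forall s, simplices K s <->
    s != fset0 /\ exists w, forall v, v \in s -> r v w) ->
  cell_complex (pair_coord pr q)
    [set c | exists s t, full r s t /\ c = cell pr q s t] ->
  (forall z, exists s t, full r s t /\ cell pr q s t z) ->
  (forall s t f g, full r s t -> geometric_simplex s f ->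
    geometric_simplex t g -> exists z, bary (pr z) = f /\ q z = g) ->
  (forall z z', bary (pr z) = bary (pr z') -> q z = q z' -> z = z') ->
  homotopy_equivalent R (realization R K) Z /\
  homotopy_equivalent R Z (realization R K).
Proof.
move=> KP Zcells Zcover Zpair Zinj.
have selex s : exists t : {fset W}, simplices K s ->
    t != fset0 /\ forall v w, v \in s -> w \in t -> r v w.
  (* For a simplex, the singleton of a witness serves as [sel s]; the empty set is a default
     elsewhere. *)
  have [Ks|nKs] := pselect (simplices K s); last by exists fset0.
  have [_ [w sw]] := (KP s).1 Ks; exists [fset w]%fset => _; split.
    by apply/fset0Pn; exists w; rewrite inE.
  by move=> v w' vs; rewrite inE => /eqP ->; exact: sw.
have [sel selP] := choice selex.
exact: (homotopy_equivalent_choice KP Zcells Zcover Zpair Zinj selP).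
Qed.

Lemma eq_complex (R : realType) (S : topologicalType) (I : Type)
    (co co' : I -> S -> R) (C C' : set (set S)) :
  co = co' -> C = C' -> cell_complex co C -> cell_complex co' C'.
Proof. by move=> -> ->. Qed.

(** Used to exchange the two summands that index the coordinates; surjectivity of [e] ensures that
    every coordinate is still tested. *)
Lemma cell_complex_reindex (R : realType) (S : topologicalType) (I J : Type)
    (co : I -> S -> R) (C : set (set S)) (e : J -> I) :
  (forall i, exists j, e j = i) -> cell_complex co C ->
  cell_complex (fun j => co (e j)) C.
Proof.
move=> esurj [cco clC wC tC]; split=> //.
move=> T f D finD DC covD fco; apply: (tC _ _ D) => // i.
by have [j <-] := esurj i; exact: fco.
Qed.

(** * The relational product of the two Dowker complexes *)

Section relational_dowker.
Variables (R : realType) (A X : choiceType) (r : set (A * X)).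

Let Z := relational_product R (induced_relation r).

Let points : set (product_complex R (dowker_left r) (dowker_right r)) :=
  \bigcup_(p in related (induced_relation r))
    closed_cell (set_val p.1) (set_val p.2).

Definition left_point (z : Z) : realization R (dowker_left r) :=
  (set_val z).1.

Definition right_point (z : Z) : realization R (dowker_right r) :=
  (set_val z).2.

(** Nonempty related sets are automatically simplices: any element of one witnesses the other. *)
Lemma full_faces s t : full (fun a x => r (a, x)) s t <->
  exists2 p, related (induced_relation r) p &
    set_val p.1 = s /\ set_val p.2 = t.
Proof.
split=> [[s0 t0 st]|[[a b] ab [<- <-]]].
  have Ks : simplices (dowker_left r) s.
    by split=> //; have /fset0Pn[x xt] := t0; exists x => a /st; exact.
  have Mt : simplices (dowker_right r) t.
    by split=> //; have /fset0Pn[a sa] := s0; exists a => x; exact: st.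
  pose a : face (dowker_left r) :=
    exist (fun u => u \in simplices (dowker_left r)) _ (mem_set Ks).
  pose b : face (dowker_right r) :=
    exist (fun u => u \in simplices (dowker_right r)) _ (mem_set Mt).
  by exists (a, b).
split; last by move=> v w; exact: ab.
- exact: simplices_neq0 (set_valP a).
- exact: simplices_neq0 (set_valP b).
Qed.

Lemma relational_point s t f g : full (fun a x => r (a, x)) s t ->
  geometric_simplex s f -> geometric_simplex t g ->
  exists z, bary (left_point z) = f /\ bary (right_point z) = g.
Proof.
move=> /full_faces[[a b] ab [/= <- <-]] sf tg.
have [p pf] := bary_surj (set_valP a) sf.
have [q qg] := bary_surj (set_valP b) tg.
have h : points (p, q).
  by exists (a, b) => //; rewrite -pf in sf; rewrite -qg in tg; split.
by exists (exist (fun u => u \in points) _ (mem_set h)).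
Qed.

Lemma relational_eq (z z' : Z) : bary (left_point z) = bary (left_point z') ->
  bary (right_point z) = bary (right_point z') -> z = z'.
Proof.
move=> /bary_inj h1 /bary_inj h2; apply: val_inj.
exact: (@injective_projections _ _ (val z) (val z') h1 h2).
Qed.

Lemma relational_cover (z : Z) :
  exists s t, full (fun a x => r (a, x)) s t /\
    geometric_simplex s (bary (left_point z)) /\
    geometric_simplex t (bary (right_point z)).
Proof.
have [[a b] ab [za zb]] := set_valP z; exists (set_val a), (set_val b).
by split=> //; apply/full_faces; exists (a, b).
Qed.

Lemma left_cells : cell_complex
  (pair_coord left_point (fun z => bary (right_point z)))
  [set c | exists s t, full (fun a x => r (a, x)) s t /\
    c = cell left_point (fun z => bary (right_point z)) s t].
Proof.
apply: eq_complex (relational_complex R (induced_relation r)).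
- by apply/funext => -[a|x].
- apply/seteqP; split=> c.
    move=> [p Qp ->]; exists (set_val p.1), (set_val p.2); split=> //.
    by apply/full_faces; exists p.
  by move=> [s [t [/full_faces[p Qp [<- <-]] ->]]]; exists p.
Qed.

Lemma right_cells : cell_complex
  (pair_coord right_point (fun z => bary (left_point z)))
  [set c | exists t s, full (fun x a => r (a, x)) t s /\
    c = cell right_point (fun z => bary (left_point z)) t s].
Proof.
pose swap (i : X + A) : A + X :=
  match i with inl x => inr x | inr a => inl a end.
have swap_surj i : exists j, swap j = i.
  by case: i => [a|x]; [exists (inr a)|exists (inl x)].
apply: eq_complex (cell_complex_reindex swap_surj left_cells).
- by apply/funext => -[x|a].
- have full_sym s t : full (fun a x => r (a, x)) s t <->
      full (fun x a => r (a, x)) t s.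
    by split=> -[s0 t0 st]; split=> // v w vs wt; exact: st.
  apply/seteqP; split=> c.
    move=> [s [t [/full_sym st ->]]]; exists t, s; split=> //.
    by apply/seteqP; split=> z [].
  move=> [t [s [/full_sym st ->]]]; exists s, t; split=> //.
  by apply/seteqP; split=> z [].
Qed.

End relational_dowker.

Theorem theorem3p24 (R : realType) (A X : choiceType) (r : set (A * X)) :
  homotopy_equivalent R
    (realization R (dowker_left r))
    (relational_product R (induced_relation r)) /\
  homotopy_equivalent R
    (relational_product R (induced_relation r))
    (realization R (dowker_right r)).
Proof.
have swap_full s t :
    full (fun x a => r (a, x)) t s -> full (fun a x => r (a, x)) s t.
  by move=> [t0 s0 ts]; split=> // a x sa tx; exact: ts.
split.
- apply: (dowker_homotopy_equivalent _ (left_cells R r) _ _ _).1.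
  + by [].
  + exact: relational_cover.
  + exact: relational_point.
  + exact: relational_eq.
(* The same result for the transposed relation, read from the product to the complex. *)
- apply: (dowker_homotopy_equivalent _ (right_cells R r) _ _ _).2.
  + by [].
  + move=> z; have [s [t [[s0 t0 st] [zs zt]]]] := relational_cover z.
    by exists t, s; split=> //; split=> // x a tx sa; exact: st.
  + move=> t s g f /swap_full st tg sf.
    by have [z [zf zg]] := relational_point st sf tg; exists z.
  + by move=> z z' h1 h2; exact: relational_eq.
Qed.
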